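(* Let $h \ge 0$ and $n \ge 1$ be integers, and let $d_1 \ge d_2 \ge \dots \ge d_n \ge h$ be positive integers. Then the sequence $\pi = (d_1, \dots, d_n)$ is $H_h$-realizable if and only if all of the following hold: $\sum_{i=1}^n d_i$ is even; $n$ is a multiple of $h+1$; and for every $k \in \{1, \dots, n\}$, \[ \sum_{i=1}^k d_i \le k(k-1) + \sum_{i=k+1}^{k+1+h-s} \min\{d_i - h + s,\, k\} + \sum_{i=k+1+h-s+1}^{n} \min\{d_i - h,\, k\}, \] where $s \in \{0, 1, \dots, h\}$ is the unique integer with $s \equiv k \pmod{h+1}$.
   Context: All graphs are simple. For a non-negative integer $h$ and a positive integer $n$ that is a multiple of $h+1$, $H_h$ denotes the graph on vertex set $\{v_1, \dots, v_n\}$ that is the disjoint union of $n/(h+1)$ cliques, each of size $h+1$, with vertex sets $V_1, \dots, V_{n/(h+1)}$, where $V_i = \{v_j : j = (i-1)(h+1) + t,\ t \in \{1, \dots, h+1\}\}$ for $i \in \{1, \dots, n/(h+1)\}$ (i.e., consecutive blocks of $h+1$ vertices form cliques). A non-increasing sequence of non-negative integers $(d_1, \dots, d_n)$ is called $H_h$-realizable if $n$ is a multiple of $h+1$ and there exists a graph $G$ with vertex set $\{v_1, \dots, v_n\}$ such that $d_G(v_i) = d_i$ for all $i$ and $G$ contains $H_h$ as a spanning subgraph. Sums with empty index range are $0$.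
   Formalization: For k = n the middle sum as printed runs over i = n+1, …, n+1+h, where d_i is undefined; the formal statement restricts all sums to indices i ≤ n, so that this sum is 0 when k = n, and changes nothing else. *)

(* Defs.v *)
From mathcomp Require Import all_boot.

Set Implicit Arguments.
Unset Strict Implicit.
Unset Printing Implicit Defensive.

(* The vertices v_1, ..., v_n are the elements of 'I_n, so that v_j is the     *)
(* ordinal of value j - 1; likewise d_j is the value of d : 'I_n -> nat there. *)

Definition simple_graph (T : finType) (e : rel T) : Prop :=
  symmetric e /\ irreflexive e.

Definition degree (T : finType) (e : rel T) (x : T) : nat :=
  #|[set y | e x y]|.

(* The block numbered b from 0, i.e. V_(b+1). *)
Definition block (h n b : nat) : {set 'I_n} :=
  [set j : 'I_n | [exists t : 'I_h.+1, j == b * h.+1 + t :> nat]].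

(* The graph H_h on n vertices; meaningful when h + 1 divides n. *)
Definition clique_factor (h n : nat) : rel 'I_n :=
  fun x y => (x != y) &&
    [exists b : 'I_(n %/ h.+1), (x \in block h n b) && (y \in block h n b)].

(* The graph e has the vertex set of H_h, so the inclusion of edge relations   *)
(* says that H_h is a spanning subgraph of e.                                  *)
Definition Hrealizable (h n : nat) (d : 'I_n -> nat) : Prop :=
  h.+1 %| n /\
  exists e : rel 'I_n,
    [/\ simple_graph e,
        forall x : 'I_n, degree e x = d x
      & subrel (@clique_factor h n) e].

(* Main.v *)
Require Import Defs.
From mathcomp Require Import all_boot.
From mathcomp Require Import zify.

Set Implicit Arguments.
Unset Strict Implicit.
Unset Printing Implicit Defensive.

(* Removing H_h from a realization leaves a factor with degrees f_i = d_i - h   *)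
(* of the complete multipartite graph K whose parts are the blocks.             *)
(* A 0/1 matrix with support in K and row and column sums f exists, by          *)
(* augmenting paths, as soon as                                                 *)
(*   sum_S f + sum_T f <= e_K(S, T) + sum f   for all vertex sets S, T.         *)
(* As f is non-increasing and e_K(S, T), given |S| and |T|, is smallest when S  *)
(* and T are prefixes, these cut conditions follow from the given inequalities. *)
(* The matrix is then made symmetric as in the factor theorem of Fulkerson,     *)
(* Hoffman and McAndrew: its one-way arcs split into closed trails, and making  *)
(* the arcs of a trail alternately two-way and absent preserves all row and     *)
(* column sums, except for an error of one at the base vertex of a trail of odd *)
(* length.  By parity odd trails come in pairs; the errors of two of them       *)
(* cancel if they share their base vertex, and are otherwise corrected on one   *)
(* edge of K joining the two trails, which exists since K is multipartite.      *)

(** * Matrices of zeros and ones with prescribed row and column sums *)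

(** Necessity is a count of the degrees of the first [k] vertices from the other ends of their
    edges. Edges inside the prefix contribute at most [k(k-1)]. A later vertex sends at most [k]
    edges into the prefix, and it spends degree on its block-mates outside the prefix: all [h] of
    them, or only [h - s] if its block is the one cut by the prefix ([realizable_bound]).

    For sufficiency, the terms with [s] are what makes the inequality imply the cut condition for
    two prefixes ([excess_prefix_bound]). [sum_set_le_prefix] and [sum_mul_truncated] extend it to
    arbitrary vertex sets ([cut_bound]), [transportation] provides the matrix, [symmetrization]
    makes it a graph, and [bound_realizable] adds the cliques back. *)

Definition rowsum (X Y : finType) (A : {set X * Y}) (x : X) : nat :=
  \sum_y ((x, y) \in A).

Definition colsum (X Y : finType) (A : {set X * Y}) (y : Y) : nat :=
  \sum_x ((x, y) \in A).

Lemma sum_rowsum (X Y : finType) (A : {set X * Y}) :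
  \sum_x rowsum A x = #|A|.
Proof.
rewrite pair_big /= -sum1_card big_mkcond /= [RHS]big_mkcond /=.
by apply: eq_bigr => -[x y] _ /=; case: ((x, y) \in A).
Qed.

Lemma sum_colsum (X Y : finType) (A : {set X * Y}) :
  \sum_y colsum A y = #|A|.
Proof. by rewrite -sum_rowsum exchange_big. Qed.

Lemma rowsumU1 (X Y : finType) (A : {set X * Y}) a x :
  a \notin A -> rowsum (a |: A) x = (x == a.1) + rowsum A x.
Proof.
case: a => a b abA; rewrite /rowsum (bigD1 b) //= [in RHS](bigD1 b) //=.
rewrite !inE xpair_eqE eqxx andbT addnA; congr (_ + _).
  by case: eqVneq => //= ->; rewrite (negbTE abA).
by apply: eq_bigr => y yb; rewrite !inE xpair_eqE (negbTE yb) andbF.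
Qed.

Lemma colsumU1 (X Y : finType) (A : {set X * Y}) a y :
  a \notin A -> colsum (a |: A) y = (y == a.2) + colsum A y.
Proof.
case: a => a b abA; rewrite /colsum (bigD1 a) //= [in RHS](bigD1 a) //=.
rewrite !inE xpair_eqE eqxx /= addnA; congr (_ + _).
  by case: eqVneq => //= ->; rewrite (negbTE abA).
by apply: eq_bigr => x xa; rewrite !inE xpair_eqE (negbTE xa).
Qed.

Lemma rowsumD1 (X Y : finType) (A : {set X * Y}) a x :
  a \in A -> (x == a.1) + rowsum (A :\ a) x = rowsum A x.
Proof. by move=> aA; rewrite -{2}(setD1K aA) rowsumU1 // !inE eqxx. Qed.

Lemma colsumD1 (X Y : finType) (A : {set X * Y}) a y :
  a \in A -> (y == a.2) + colsum (A :\ a) y = colsum A y.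
Proof. by move=> aA; rewrite -{2}(setD1K aA) colsumU1 // !inE eqxx. Qed.

Section Transportation.

Variables (X Y : finType) (K : X -> Y -> bool) (r : X -> nat) (c : Y -> nat).

Definition partial_plan (A : {set X * Y}) : bool :=
  [&& [forall a in A, K a.1 a.2], [forall x, rowsum A x <= r x]
    & [forall y, colsum A y <= c y]].

Lemma partial_planP (A : {set X * Y}) :
  reflect [/\ forall x y, (x, y) \in A -> K x y,
              forall x, rowsum A x <= r x & forall y, colsum A y <= c y]
          (partial_plan A).
Proof.
apply: (iffP and3P) => [[/forall_inP AK /forallP rA /forallP cA]|[AK rA cA]].
  by split=> // x y /AK.
split; [apply/forall_inP=> -[x y] /AK // | exact/forallP | exact/forallP].
Qed.

(** One step of an alternating path: row [x] can take over from row [x'] its unit in column [y]. *)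
Definition shift_rel (A : {set X * Y}) : rel X := fun x x' =>
  [exists y, [&& K x y, (x, y) \notin A & (x', y) \in A]].

(** Induction from the far end of the path: the last row [z] takes the free column [y] and releases
    [y1], which its predecessor can use. Row sums are kept, and the rest of the path survives
    because it avoids [z]. *)
Lemma augment (A : {set X * Y}) x p y :
    partial_plan A -> path (shift_rel A) x p -> uniq (x :: p) ->
    rowsum A x < r x -> K (last x p) y -> (last x p, y) \notin A ->
    colsum A y < c y ->
  exists2 B, partial_plan B & #|A| < #|B|.
Proof.
elim/last_ind: p A y => [|p z IHp] A y /partial_planP[AK rA cA].
  rewrite /= => _ _ rx Kxy xyA cy; exists ((x, y) |: A); last by rewrite cardsU1 xyA.
  apply/partial_planP; split.
  - by move=> x' y'; rewrite !inE => /orP[/eqP[-> ->]|/AK].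
  - by move=> x'; have := rA x'; rewrite rowsumU1 //=; case: eqP => [->|_] /=; lia.
  - by move=> y'; have := cA y'; rewrite colsumU1 //=; case: eqP => [->|_] /=; lia.
rewrite rcons_path last_rcons -rcons_cons rcons_uniq.
move=> /andP[xp /existsP[y1 /and3P[Ky1 ny1 zy1]]] /andP[zp up] rx Kzy zyA cy.
have neq_yy1: y != y1 by apply: contraNneq zyA => ->.
have nB : (z, y) \notin A :\ (z, y1) by rewrite !inE (negbTE zyA) andbF.
set B := (z, y) |: (A :\ (z, y1)).
have rB x' : rowsum B x' = rowsum A x'.
  by rewrite rowsumU1 // -(rowsumD1 x' zy1).
have cB y' : (y' == y1) + colsum B y' = (y' == y) + colsum A y'.
  by rewrite colsumU1 // -(colsumD1 y' zy1) addnCA.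
have BE x' y' : x' != z -> ((x', y') \in B) = ((x', y') \in A).
  by move=> xz; rewrite !inE !xpair_eqE (negbTE xz).
have lz : last x p != z.
  by apply: contraNneq zp => <-; rewrite mem_last.
have cardB : #|A| = #|B| by rewrite -!sum_rowsum; apply: eq_bigr => x' _.
rewrite cardB; apply: (IHp B y1); rewrite ?rB ?BE //.
- apply/partial_planP; split.
  + by move=> x' y'; rewrite !inE => /orP[/eqP[-> ->]|/andP[_ /AK]].
  + by move=> x'; rewrite rB.
  + move=> y'; have := cB y'; have := cA y'; case: eqP => [->|_]; case: eqP => [->|_]; lia.
- apply: (@sub_in_path _ (fun x' => x' != z) (shift_rel A)) xp.
    move=> x1 x2; move=> x1z x2z /existsP[y' Hy']; apply/existsP.
    by exists y'; rewrite !BE.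
  apply/allP => x' x'p; by apply: contraNneq zp => <-.
- have := cB y1; have := cA y1; rewrite eqxx [y1 == y]eq_sym (negbTE neq_yy1); lia.
Qed.

(** Max-flow min-cut: if a largest partial plan left a row [x0] short, the rows reachable from it by
    alternating paths would violate the cut condition. *)
Lemma transportation :
    \sum_x r x = \sum_y c y ->
    (forall (S : {set X}) (T : {set Y}), \sum_(x in S) r x <=
       \sum_(x in S) \sum_(y in T) K x y + \sum_(y | y \notin T) c y) ->
  exists A : {set X * Y}, [/\ forall x y, (x, y) \in A -> K x y,
    forall x, rowsum A x = r x & forall y, colsum A y = c y].
Proof.
move=> rc cut.
have plan0 : partial_plan set0.
  apply/partial_planP; split=> [x y|x|y]; first by rewrite inE.
    by rewrite /rowsum big1 // => y; rewrite inE.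
  by rewrite /colsum big1 // => x; rewrite inE.
case: (@arg_maxnP _ set0 partial_plan (fun A => #|A|) plan0) => A planA maxA.
have /partial_planP[AK rA cA] := planA.
have [x0 rx0|rE] := pickP (fun x => rowsum A x < r x); last first.
  have {}rE x : rowsum A x = r x by have := rA x; have := rE x; lia.
  exists A; split=> // y; apply/eqP; rewrite eqn_leq cA.
  have : \sum_y c y <= \sum_y colsum A y.
    by rewrite -rc sum_colsum -sum_rowsum; apply: leq_sum => x _; rewrite rE.
  rewrite (bigD1 y) // [leqRHS](bigD1 y) //=.
  have : \sum_(y' | y' != y) colsum A y' <= \sum_(y' | y' != y) c y'.
    exact: leq_sum.
  lia.
pose S := [set x | connect (shift_rel A) x0 x].
(* The columns that a reachable row could still use. They are full by [augment], their units lie in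
   rows of [S], and outside them the rows of [S] use every cell of [K]; so [S] and the complement of
   [T] form the violated cut. *)
pose T := [set y | [exists x in S, K x y && ((x, y) \notin A)]].
have cT y : y \in T -> colsum A y = c y.
  rewrite inE => /exists_inP[x]; rewrite inE => /connectP[p].
  move=> /shortenP[p' pp' up' _ ->] /andP[Kxy xyA].
  apply/eqP; rewrite eqn_leq cA leqNgt; apply/negP => cy.
  have [B planB] := augment planA pp' up' rx0 Kxy xyA cy.
  by rewrite ltnNge; have := maxA B planB; move=> /= ->.
have TS x y : y \in T -> (x, y) \in A -> x \in S.
  rewrite inE => /exists_inP[x']; rewrite !inE => cx' /andP[Kxy xyA] xyA'.
  by apply: (connect_trans cx'); apply: connect1; apply/existsP; exists y; apply/and3P.
have KA x y : x \in S -> y \notin T -> K x y -> (x, y) \in A.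
  move=> xS yT Kxy; apply: contraR yT => xyA; rewrite inE.
  by apply/exists_inP; exists x; rewrite ?Kxy.
have rS : \sum_(x in S) rowsum A x < \sum_(x in S) r x.
  have x0S : x0 \in S by rewrite inE.
  rewrite (bigD1 x0) // [leqRHS](bigD1 x0) //= -addSn leq_add //.
  exact: leq_sum.
have := leq_trans rS (cut S (~: T)); rewrite ltnNge => /negP[].
under [X in _ + X]eq_bigl do rewrite in_setC negbK.
under [X in _ + X]eq_bigr => y yT do rewrite -(cT y yT).
rewrite [X in _ <= X](eq_bigr (fun x => \sum_(y in ~: T) ((x, y) \in A) +
    \sum_(y in T) ((x, y) \in A))); last first.
  move=> x _; rewrite /rowsum (bigID (mem T)) /= addnC; congr (_ + _).
  by apply: eq_bigl => y; rewrite in_setC.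
rewrite big_split; apply: leq_add.
  apply: leq_sum => x xS; apply: leq_sum => y; rewrite in_setC => yT.
  by case Kxy: (K x y) => //=; rewrite (KA x y xS yT Kxy).
rewrite [leqRHS]exchange_big /=; apply: leq_sum => y yT.
rewrite /colsum [leqLHS]big_mkcond /= [leqRHS]big_mkcond; apply: leq_sum => x _ /=.
case xyA: ((x, y) \in A) => //.
by rewrite (TS x y yT xyA).
Qed.
End Transportation.

(** * Symmetrization *)

Definition swap_arc (V : finType) (a : V * V) : V * V := (a.2, a.1).

Lemma swap_arcK (V : finType) : involutive (@swap_arc V).
Proof. by case. Qed.

Definition one_way (V : finType) (A : {set V * V}) : {set V * V} :=
  [set a in A | swap_arc a \notin A].

Lemma even_symmetric_arcs (V : finType) (E : {set V * V}) :
    (forall a, a \in E -> swap_arc a \in E) -> (forall a, a \in E -> a.1 != a.2) ->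
  ~~ odd #|E|.
Proof.
move=> Esym Eirr; pose P := [set a : V * V | enum_rank a.1 < enum_rank a.2].
rewrite -(cardsID P E).
suff -> : #|E :\: P| = #|E :&: P| by rewrite oddD addbb.
rewrite -(card_imset _ (inv_inj (@swap_arcK V))); apply: eq_card => a.
rewrite -{1}[a]swap_arcK (mem_imset _ _ (inv_inj (@swap_arcK V))) !inE /=.
have -> : (swap_arc a \in E) = (a \in E).
  by apply/idP/idP => [/Esym|/Esym //]; rewrite swap_arcK.
rewrite andbC; case aE: (a \in E) => //=; rewrite -leqNgt ltn_neqAle.
case: eqP => // /val_inj /enum_rank_inj e.
by have := Eirr a aE; rewrite e eqxx.
Qed.

Lemma sum_arcs_from (V : finType) (F : V * V -> nat) x :
  \sum_y F (x, y) = \sum_(a | a.1 == x) F a.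
Proof.
rewrite [RHS](reindex_onto (fun y => (x, y)) snd) /=.
  by apply: eq_bigl => y; rewrite !eqxx.
by move=> -[x' y] /= /eqP->.
Qed.

Lemma sum_arcs_to (V : finType) (F : V * V -> nat) y :
  \sum_x F (x, y) = \sum_(a | a.2 == y) F a.
Proof.
rewrite (reindex_inj (inv_inj (@swap_arcK V))) /=.
by rewrite -(sum_arcs_from (fun a => F (swap_arc a))).
Qed.

(** At each vertex the incoming arcs are matched with the equally many outgoing ones, by position in
    two enumerations. The orbits of [s] in [M] are then closed trails. *)
Lemma arc_successor (V : finType) (M : {set V * V}) :
    (forall v, rowsum M v = colsum M v) ->
  exists2 s : V * V -> V * V, injective s &
    forall a, a \in M -> s a \in M /\ (s a).1 = a.2.
Proof.
move=> bal.
pose out v := [set a in M | a.1 == v]; pose inn v := [set a in M | a.2 == v].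
have size_out v : size (enum (out v)) = size (enum (inn v)).
  rewrite -!cardE -!sum1dep_card.
  have := bal v; rewrite /rowsum /colsum.
  rewrite (sum_arcs_from (fun a => a \in M : nat)) (sum_arcs_to (fun a => a \in M : nat)).
  rewrite !big_mkcondl => e.
  have toif (P : pred (V * V)) :
      \sum_(a | P a) (if a \in M then 1 else 0) = \sum_(a | P a) (a \in M).
    by apply: eq_bigr => a _; case: (a \in M).
  by rewrite (toif (fun a => a.1 == v)) (toif (fun a => a.2 == v)).
(* Being the identity off [M] keeps [s] injective on all pairs. *)
pose s a := if a \in M then nth a (enum (out a.2)) (index a (enum (inn a.2))) else a.
have idx a : a \in M -> index a (enum (inn a.2)) < size (enum (out a.2)).
  by move=> aM; rewrite size_out index_mem mem_enum inE aM eqxx.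
have sM a : a \in M -> s a \in M /\ (s a).1 = a.2.
  move=> aM; have := mem_nth a (idx a aM).
  by rewrite mem_enum /s aM inE => /andP[-> /eqP].
exists s => // a b; have [aM|aM] := boolP (a \in M); have [bM|bM] := boolP (b \in M).
- have [_ sa] := sM a aM; have [_ sb] := sM b bM => e.
  have ab : a.2 = b.2 by rewrite -sa e sb.
  move: e; rewrite /s aM bM.
  rewrite (set_nth_default b) ?idx // -ab => /eqP.
  rewrite nth_uniq ?enum_uniq ?idx //; last by rewrite ab idx.
  have bin : b \in enum (inn a.2) by rewrite mem_enum inE bM ab eqxx.
  move/eqP/(congr1 (nth b (enum (inn a.2)))).
  by rewrite !nth_index // mem_enum inE aM eqxx.
- by move=> e; have [] := sM a aM; rewrite e /s (negbTE bM) (negbTE bM).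
- by move=> e; have [] := sM b bM; rewrite -e /s (negbTE aM) (negbTE aM).
- by rewrite /s (negbTE aM) (negbTE bM).
Qed.

(** Colour by parity of the distance from [a0]; on an odd cycle the only clash is on returning to
    [a0]. *)
Lemma orbit_coloring (T : finType) (s : T -> T) (a0 : T) (beta : bool) :
    injective s ->
  exists2 c : T -> bool, c a0 = beta & forall a, fconnect s a0 a ->
    c (s a) = c a (+) ~~ (odd (order s a0) && (s a == a0)).
Proof.
move=> sinj; exists (fun a => beta (+) odd (findex s a0 a)).
  by rewrite findex0 addbF.
move=> a ca; have := findex_max ca; set i := findex s a0 a => io.
have sa : s a = iter i.+1 s a0 by rewrite /= iter_findex.
rewrite -addbA; congr (_ (+) _).
move: io; rewrite leq_eqVlt => /predU1P[io|io].
  have sa0 : s a = a0 by rewrite sa io iter_order.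
  by rewrite sa0 findex0 eqxx andbT -io /= negbK addbb.
have fsa : findex s a0 (s a) = i.+1 by rewrite sa findex_iter.
have -> : (s a == a0) = false.
  by apply/eqP => e; move: fsa; rewrite e findex0.
by rewrite fsa andbF addbT.
Qed.

(* The arcs of an orbit of [s], coloured alternately, become two-way or absent.
   Around an odd orbit two consecutive arcs at its base have the same colour. *)
Lemma flip_orbit (V : finType) (A : {set V * V}) (s : V * V -> V * V)
    (a0 : V * V) (beta : bool) :
    injective s ->
    (forall a, fconnect s a0 a -> a \in one_way A /\ (s a).1 = a.2) ->
  exists B : {set V * V}, let o x := odd (order s a0) && (x == a0.1) in
    [/\ forall x, rowsum B x + (o x && ~~ beta) = rowsum A x + (o x && beta),
        forall x, colsum B x + (o x && ~~ beta) = colsum A x + (o x && beta),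
        one_way B = one_way A :\: [set a | fconnect s a0 a]
      & forall a, a \in B -> (a \in A) || (swap_arc a \in A)].
Proof.
move=> sinj hC; have [c ca0 cs] := orbit_coloring a0 beta sinj.
set C := [set a | fconnect s a0 a].
have CE a : (a \in C) = fconnect s a0 a by rewrite inE.
clearbody C.
have CA a : a \in C -> (a \in A) * (swap_arc a \in A = false) * (swap_arc a \in C = false).
  rewrite CE => /hC[]; rewrite inE => /andP[aA saA] _.
  rewrite aA (negbTE saA); split=> //; apply/negbTE; rewrite CE.
  by apply: contra saA => /hC[]; rewrite inE => /andP[].
have sC a : (s a \in C) = (a \in C).
  by rewrite !CE -(same_fconnect1_r sinj).
pose B := [set a | if a \in C then c a else
                   if swap_arc a \in C then c (swap_arc a) else a \in A].
have BE a : (a \in B) + (a \in C) =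
    (a \in A) + ((a \in C) && c a) + ((swap_arc a \in C) && c (swap_arc a)).
  rewrite inE; case aC: (a \in C).
    by rewrite !CA //= addn0 addnC.
  case saC: (swap_arc a \in C) => /=; last by lia.
  by have := CA _ saC; rewrite swap_arcK => -[[_ ->]]; lia.
(* The arcs of the orbit leaving [x] are the successors of those entering [x]. *)
have shift (g : pred (V * V)) x : \sum_y ((x, y) \in C) && g (x, y)
    = \sum_y ((y, x) \in C) && g (s (y, x)).
  rewrite (sum_arcs_from (fun a => (a \in C) && g a : nat)).
  rewrite (sum_arcs_to (fun a => (a \in C) && g (s a) : nat)).
  rewrite (reindex_inj sinj) /= [LHS]big_mkcond [RHS]big_mkcond /=.
  apply: eq_bigr => a _; rewrite sC; case aC: (a \in C) => /=; last by rewrite !if_same.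
  by move: aC; rewrite CE => /hC[_ ->].
(* An arc entering [x] and its successor have opposite colours, so each such pair has one coloured
   arc, except where an odd orbit closes at its base. *)
have twist x : \sum_y ((y, x) \in C) && c (y, x) + \sum_y ((x, y) \in C) && c (x, y)
      + (odd (order s a0) && (x == a0.1) && ~~ beta)
    = \sum_y ((y, x) \in C) + (odd (order s a0) && (x == a0.1) && beta).
  have tw (b : bool) : \sum_y ((y, x) \in C) && (odd (order s a0) && (s (y, x) == a0) && b)
      = odd (order s a0) && (x == a0.1) && b.
    rewrite -(shift (fun a => odd (order s a0) && (a == a0) && b)).
    have eqa0 y : ((x, y) == a0) = (x == a0.1) && (y == a0.2) by rewrite -pair_eqE.
    rewrite (bigD1 a0.2) //= big1 => [|y /negbTE ya]; last first.
      by rewrite eqa0 ya !andbF.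
    rewrite addn0 eqa0 eqxx andbT; case: eqVneq => [->|_]; last by rewrite !andbF.
    by rewrite -surjective_pairing CE connect0.
  rewrite (shift c) -!tw -!big_split /=; apply: eq_bigr => y _.
  case yxC: ((y, x) \in C) => //=.
  move: (yxC); rewrite CE => /cs cse.
  have [/andP[o /eqP e]|/negbTE ne] := boolP (odd (order s a0) && (s (y, x) == a0)).
    by move: cse; rewrite e o ca0 eqxx /= addbF => <-; case: (beta).
  by rewrite cse ne /= addbT; case: (c _).
have sum_out x : \sum_y ((x, y) \in C) = \sum_y ((y, x) \in C).
  have := shift xpredT x.
  by under eq_bigr do rewrite andbT; under [RHS]eq_bigr do rewrite andbT.
exists B; split.
- move=> x; have := twist x.
  have : rowsum B x + \sum_y ((x, y) \in C) = rowsum A x +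
      \sum_y ((x, y) \in C) && c (x, y) + \sum_y ((y, x) \in C) && c (y, x).
    by rewrite /rowsum -!big_split /=; apply: eq_bigr => y _; apply: BE.
  by rewrite sum_out; lia.
- move=> x; have := twist x.
  have : colsum B x + \sum_y ((y, x) \in C) = colsum A x +
      \sum_y ((y, x) \in C) && c (y, x) + \sum_y ((x, y) \in C) && c (x, y).
    by rewrite /colsum -!big_split /=; apply: eq_bigr => y _; apply: BE.
  by lia.
- apply/setP => a; rewrite !inE swap_arcK.
  case aC: (a \in C); first by rewrite !CA //= andbN.
  case saC: (swap_arc a \in C) => //=.
  by have := CA _ saC; rewrite swap_arcK => -[[_ ->]] _; rewrite andbN.
- move=> a; rewrite inE; have [aC|_] := boolP (a \in C); first by rewrite !(CA _ aC).
  by have [saC _|_ ->] := boolP (swap_arc a \in C); rewrite ?(CA _ saC).1.1 ?orbT.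
Qed.

Lemma one_way_balanced (V : finType) (A : {set V * V}) :
    (forall v, rowsum A v = colsum A v) ->
  forall v, rowsum (one_way A) v = colsum (one_way A) v.
Proof.
move=> bal v.
suff : rowsum A v + colsum (one_way A) v = colsum A v + rowsum (one_way A) v.
  by rewrite bal => /addnI.
rewrite /rowsum /colsum -!big_split /=; apply: eq_bigr => y _.
by rewrite !inE /swap_arc /=; do 2!case: (_ \in A).
Qed.

Lemma even_one_way (V : finType) (A : {set V * V}) :
    (forall a, a \in A -> a.1 != a.2) -> ~~ odd #|A| -> ~~ odd #|one_way A|.
Proof.
move=> Airr evA; pose E := [set a in A | swap_arc a \in A].
have evE : ~~ odd #|E|.
  apply: even_symmetric_arcs => a; rewrite !inE ?swap_arcK; first by rewrite andbC.
  by case/andP=> /Airr.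
have : #|A| = #|E| + #|one_way A|.
  rewrite -(cardsID [set a | swap_arc a \in A] A); congr (_ + _).
    by apply: eq_card => a; rewrite !inE.
  by apply: eq_card => a; rewrite !inE andbC.
by move: evA => /[swap] ->; rewrite oddD (negbTE evE).
Qed.

(** The correction for two odd trails with different bases: a pair that is two-way or absent can be
    switched without affecting the one-way arcs. *)
Lemma toggle_edge (V : finType) (A : {set V * V}) (u v : V) (beta : bool) :
    u != v -> ((u, v) \in A) = beta -> ((v, u) \in A) = beta ->
  exists B : {set V * V}, let o x := (x == u) + (x == v) in
    [/\ forall x, rowsum B x + beta * o x = rowsum A x + ~~ beta * o x,
        forall x, colsum B x + beta * o x = colsum A x + ~~ beta * o x,
        one_way B = one_way A
      & forall a, a \in B -> [|| a \in A, a == (u, v) | a == (v, u)]].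
Proof.
move=> uv; have uvE : ((u, v) == (v, u)) = false by rewrite xpair_eqE (negbTE uv).
have uvE' : ((v, u) == (u, v)) = false by rewrite eq_sym.
case: beta => uvA vuA.
  have uvA' : (v, u) \in A :\ (u, v) by rewrite !inE vuA uvE'.
  exists (A :\ (u, v) :\ (v, u)); split=> [x|x||a].
  - by rewrite -(rowsumD1 x uvA) -(rowsumD1 x uvA') /=; case: (x == u); case: (x == v); move: (_ x) => t; lia.
  - by rewrite -(colsumD1 x uvA) -(colsumD1 x uvA') /=; case: (x == u); case: (x == v); move: (_ x) => t; lia.
  - apply/setP => a; rewrite !inE.
    have [->|auv] := eqVneq a (u, v); first by rewrite /swap_arc /= vuA uvA !andbF.
    have [->|avu] := eqVneq a (v, u); first by rewrite /swap_arc /= vuA uvA !andbF.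
    by rewrite !(inv_eq (@swap_arcK V)) /swap_arc /= auv avu.
  - by rewrite !inE => /and3P[_ _ ->].
have uvA' : (u, v) \notin (v, u) |: A by rewrite !inE uvA uvE.
exists ((u, v) |: ((v, u) |: A)); split=> [x|x||a].
- by rewrite !rowsumU1 ?vuA //=; case: (x == u); case: (x == v); move: (_ x) => t; lia.
- by rewrite !colsumU1 ?vuA //=; case: (x == u); case: (x == v); move: (_ x) => t; lia.
- apply/setP => a; rewrite !inE.
  have [->|auv] := eqVneq a (u, v); first by rewrite /swap_arc /= vuA uvA eqxx ?orbT ?andbF.
  have [->|avu] := eqVneq a (v, u); first by rewrite /swap_arc /= vuA uvA eqxx ?orbT ?andbF.
  by rewrite !(inv_eq (@swap_arcK V)) /swap_arc /= (negbTE auv) (negbTE avu).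
- by rewrite !inE => /or3P[->|->|->]; rewrite ?orbT.
Qed.

Lemma symmetrization (V : finType) (K : rel V) (f : V -> nat) (A : {set V * V}) :
    symmetric K -> irreflexive K -> (forall x y z, K x y -> K z x || K z y) ->
    ~~ odd (\sum_v f v) ->
    (forall a, a \in A -> K a.1 a.2) ->
    (forall v, rowsum A v = f v) -> (forall v, colsum A v = f v) ->
  exists B : {set V * V}, [/\ forall a, a \in B -> K a.1 a.2,
    forall a, a \in B -> swap_arc a \in B & forall v, rowsum B v = f v].
Proof.
move=> Ksym Kirr Kmul fev.
have [m] := ubnP #|one_way A|; elim: m A => // m IHm A /ltnSE cardA AK rA cA.
have bal v : rowsum A v = colsum A v by rewrite rA cA.
have [s sinj sM] := arc_successor (one_way_balanced bal).
have orbM a b : a \in one_way A -> fconnect s a b -> b \in one_way A.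
  move=> aM /iter_findex <-; elim: (findex s a b) => //= i iM.
  by have [] := sM _ iM.
have sM2 a b : a \in one_way A -> fconnect s a b ->
    b \in one_way A /\ (s b).1 = b.2.
  by move=> aM ab; have bM := orbM _ _ aM ab; have [] := sM b bM.
have fsym := fconnect_sym sinj.
(* Induction on the number of one-way arcs; without any, [A] is already symmetric. *)
have [M0|[a aM]] := set_0Vmem (one_way A).
  exists A; split=> // a aA; apply: contraT => saA.
  by have := in_set0 a; rewrite -M0 inE aA saA.
have step (B : {set V * V}) b :
    (forall a, a \in B -> K a.1 a.2) -> (forall v, rowsum B v = f v) ->
    (forall v, colsum B v = f v) -> one_way B \subset one_way A ->
    b \in one_way A -> b \notin one_way B ->
  exists B : {set V * V}, [/\ forall a, a \in B -> K a.1 a.2,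
    forall a, a \in B -> swap_arc a \in B & forall v, rowsum B v = f v].
  move=> BK rB cB BA bA bB; apply: (IHm B) => //.
  apply: leq_trans cardA; apply: proper_card; apply/properP; split=> //.
  by exists b.
have swapK (B C : {set V * V}) : (forall a, a \in B -> K a.1 a.2) ->
    (forall a, a \in C -> (a \in B) || (swap_arc a \in B)) ->
    forall a, a \in C -> K a.1 a.2.
  by move=> BK CB a' /CB/orP[/BK//|/BK]; rewrite Ksym.
have [b /andP[bM evb]|odd_orbit] := pickP (fun b => (b \in one_way A) && ~~ odd (order s b)).
  have [B [rB cB MB BA]] := flip_orbit true sinj (fun c => @sM2 b c bM).
  apply: (step B b) => //.
  - exact: swapK BA.
  - by move=> v; have := rB v; rewrite (negbTE evb) /= !addn0 rA.
  - by move=> v; have := cB v; rewrite (negbTE evb) /= !addn0 cA.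
  - by rewrite MB subsetDl.
  - by rewrite MB !inE connect0.
have oddM b : b \in one_way A -> odd (order s b).
  by move=> bM; have := odd_orbit b; rewrite bM => /negbT; rewrite negbK.
(* Flipping the odd orbits of [b] and [c] in turn corrects errors of one at their bases. *)
have flip2 (A' : {set V * V}) (b c : V * V) (beta gamma : bool) :
    one_way A' = one_way A -> (forall a, a \in A' -> K a.1 a.2) ->
    b \in one_way A -> c \in one_way A -> ~~ fconnect s b c ->
    (forall x, rowsum A' x + ((x == b.1) && beta) + ((x == c.1) && gamma)
       = f x + ((x == b.1) && ~~ beta) + ((x == c.1) && ~~ gamma)) ->
    (forall x, colsum A' x + ((x == b.1) && beta) + ((x == c.1) && gamma)
       = f x + ((x == b.1) && ~~ beta) + ((x == c.1) && ~~ gamma)) ->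
  exists B : {set V * V}, [/\ forall a, a \in B -> K a.1 a.2,
    forall a, a \in B -> swap_arc a \in B & forall v, rowsum B v = f v].
  move=> MA' A'K bM cM nbc rA' cA'.
  have hb d : fconnect s b d -> d \in one_way A' /\ (s d).1 = d.2.
    by rewrite MA'; apply: sM2.
  have [B [rB cB MB BA]] := flip_orbit beta sinj hb.
  have hc d : fconnect s c d -> d \in one_way B /\ (s d).1 = d.2.
    move=> cd; have [dM sd] := sM2 c d cM cd; split=> //.
    rewrite MB MA' !inE /= in dM *; rewrite dM andbT.
    by apply: contra nbc => bd; rewrite (connect_trans bd) // fsym.
  have [C [rC cC MC CB]] := flip_orbit gamma sinj hc.
  apply: (step C b) => //.
  - exact: swapK (swapK _ _ A'K BA) CB.
  - by move=> x; have := rC x; have := rB x; have := rA' x; rewrite !oddM //=; clear; lia.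
  - by move=> x; have := cC x; have := cB x; have := cA' x; rewrite !oddM //=; clear; lia.
  - by rewrite MC MB MA' (subset_trans (subsetDl _ _)) // subsetDl.
  - by rewrite MC MB !inE connect0 !andbF.
(* Two odd orbits with a common base: flipped with opposite colours, their errors cancel. *)
have [[b c] /and4P[/= bM cM /eqP bc nbc]|same_source] := pickP (fun bc : (V * V) * (V * V) =>
    [&& bc.1 \in one_way A, bc.2 \in one_way A, bc.1.1 == bc.2.1
      & ~~ fconnect s bc.1 bc.2]).
  apply: (flip2 A b c true false) => // x; rewrite bc ?rA ?cA; clear; lia.
have sourceC b c : b \in one_way A -> c \in one_way A -> b.1 = c.1 -> fconnect s b c.
  move=> bM cM bc; apply: contraFT (same_source (b, c)) => nbc /=.
  by rewrite bM cM bc eqxx.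
have evM : ~~ odd #|one_way A|.
  apply: even_one_way => [b /AK|]; first by apply: contraTneq => ->; rewrite Kirr.
  by rewrite -sum_rowsum (eq_bigr f).
(* A single orbit would make the number of one-way arcs odd. *)
have [b bM nab] : exists2 b, b \in one_way A & ~~ fconnect s a b.
  apply/exists_inP; apply: contraNT evM => /exists_inPn nall.
  suff -> : #|one_way A| = order s a by apply: oddM.
  apply: eq_card => b; apply/idP/idP; last exact: orbM.
  by move=> /nall; rewrite negbK.
(* [a.1] is adjacent in [K] to an end of [b]; if it is the head, that is the source of [s b], an arc
   of the same orbit. *)
have [c [cM nac Kac]] : exists c, [/\ c \in one_way A, ~~ fconnect s a c & K a.1 c.1].
  have bA : b \in A by move: bM; rewrite inE => /andP[].
  have /orP[Kab|Kab] := Kmul _ _ a.1 (AK b bA); first by exists b.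
  have [sbM sb] := sM b bM; exists (s b); rewrite sb; split=> //.
  by apply: contra nab => /connect_trans; apply; rewrite fsym fconnect1.
have uv : a.1 != c.1 by apply: contraTneq Kac => ->; rewrite Kirr.
(* A one-way arc from [a.1] to [c.1] would be in the orbit of [a] by its source, and its successor
   in the orbit of [c]. *)
have crossing x y : (x, y) \in one_way A -> ~~ ((x == a.1) && (y == c.1)).
  move=> xyM; apply: contra nac => /andP[/eqP xa /eqP yc].
  have [sM' s1] := sM _ xyM.
  apply: connect_trans (sourceC a (x, y) aM xyM (esym xa)) _.
  by apply: connect_trans (fconnect1 _ _) _; apply: sourceC => //; rewrite s1.
have crossing' x y : (x, y) \in one_way A -> ~~ ((x == c.1) && (y == a.1)).
  move=> xyM; apply: contra nac => /andP[/eqP xc /eqP ya].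
  have [sM' s1] := sM _ xyM; rewrite fsym.
  apply: connect_trans (sourceC c (x, y) cM xyM (esym xc)) _.
  by apply: connect_trans (fconnect1 _ _) _; apply: sourceC => //; rewrite s1.
have vuA : ((c.1, a.1) \in A) = ((a.1, c.1) \in A).
  have := crossing a.1 c.1; have := crossing' c.1 a.1.
  rewrite !inE /swap_arc /= !eqxx /=.
  by case: (_ \in A); case: (_ \in A) => //= h1 h2; by [have := h1 isT | have := h2 isT].
have [B [rB cB MB BA]] := toggle_edge uv erefl vuA.
have BK a' : a' \in B -> K a'.1 a'.2.
  by move=> /BA/or3P[/AK//|/eqP->|/eqP->] //=; rewrite Ksym.
(* If the edge was present, it has been removed and both flips add one at their bases; otherwise
   both subtract one. *)
move: rB cB; case: ((a.1, c.1) \in A) => rB cB.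
- by apply: (flip2 B a c true true) => // x; rewrite !andbT !andbF !addn0 -addnA;
    [have := rB x; rewrite rA | have := cB x; rewrite cA]; rewrite mul1n mul0n addn0.
- by apply: (flip2 B a c false false) => // x; rewrite !andbT !andbF !addn0 -addnA;
    [have := rB x; rewrite rA | have := cB x; rewrite cA]; rewrite mul1n mul0n addn0.
Qed.

(** * Prefixes minimize cuts *)

(* For [\sum_i a i = k] and [\sum_i b i = l] the bound is attained by filling the
   blocks of size [w] one after the other with [k], respectively [l], elements. *)
Lemma sum_mul_truncated (I : finType) (w q s : nat) (a b : I -> nat) :
    (forall i, a i <= w) -> (forall i, b i <= w) -> s < w ->
    \sum_i a i = q * w + s -> \sum_i a i <= \sum_i b i ->
  \sum_i a i * b i + s * (q.+1 * w - \sum_i b i) <= w * \sum_i a i.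
Proof.
move=> aw bw sw suma le_ab.
have trivial_bound : \sum_i a i * b i <= w * \sum_i a i.
  by rewrite big_distrr; apply: leq_sum => i _ /=; rewrite mulnC leq_mul2r bw orbT.
have [->|s_gt0] := posnP s; first by rewrite mul0n addn0.
have [lb|lb] := leqP (q.+1 * w) (\sum_i b i).
  by move: lb; rewrite -subn_eq0 => /eqP->; rewrite muln0 addn0.
pose N t := #|[set i | t <= a i]|.
have NE t : N t = \sum_i (t <= a i).
  by rewrite /N -sum1dep_card big_mkcond; apply: eq_bigr => i _; case: leqP.
have N0 : q < N 0.
  rewrite /N -sum1dep_card sum1_card.
  have : \sum_i a i <= #|I| * w.
    by rewrite -sum_nat_const; apply: leq_sum => i _.
  rewrite suma; case: leqP => // Iq.
  by have := leq_mul (Iq : #|I| <= q) (leqnn w); lia.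
have N_le t : q < N t -> t <= w.
  rewrite /N => /(leq_trans (ltn0Sn _)) /card_gt0P[i]; rewrite inE => /leq_trans; exact.
(* [th] is the [q+1]-st largest value of [a]. *)
have [th Nth maxth] := ex_maxnP (ex_intro (fun t => q < N t) 0 N0) N_le.
have Nth1 : N th.+1 <= q by case: leqP => // /maxth; rewrite ltnn.
pose Z := \sum_i (a i - th).
have thw := N_le _ Nth.
(* [Z] is the total excess over [th]: at most [q] values exceed [th] ([Z1]), while at least [q.+1]
   reach it ([Z2]). [Z3] bounds each product by splitting [a i] at [th]. *)
have Z1 : Z <= q * (w - th).
  apply: leq_trans (_ : N th.+1 * (w - th) <= _); last by rewrite leq_mul2r Nth1 orbT.
  rewrite NE big_distrl /=; apply: leq_sum => i _.
  by have := aw i; case: ltnP => /= H1 H2; lia.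
have Z2 : Z + q.+1 * th <= q * w + s.
  rewrite -suma; apply: leq_trans (_ : Z + N th * th <= _).
    by rewrite leq_add2l leq_mul2r Nth orbT.
  rewrite NE big_distrl /= -big_split /=; apply: leq_sum => i _.
  by case: leqP => /= H2; lia.
have Z3 : \sum_i a i * b i <= th * \sum_i b i + w * Z.
  rewrite !big_distrr -big_split /=; apply: leq_sum => i _.
  by have := aw i; have := bw i; have [] := leqP (a i) th; nia.
move: (\sum_i b i) le_ab lb Z3 => l; rewrite suma.
move: (\sum_i _ * _) => P; clear - Z1 Z2 thw => le_ab lb Z3.
have [t lE] : exists t, l = q * w + t by exists (l - q * w); lia.
have tw : t < w by lia.
(* With [l = q * w + t], the bound [th * l + w * Z] of [Z3] equals [(w - t) * (Z + q * th) + t * (Z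
   + q.+1 * th)]; [Z1] and [Z2] bound the two brackets. *)
have : (w - t) * (Z + q * th) <= (w - t) * (q * w) by rewrite leq_mul2l; apply/orP; right; nia.
have : t * (Z + q.+1 * th) <= t * (q * w + s) by rewrite leq_mul2l Z2 orbT.
have [u wE] : exists u, w = t + u by exists (w - t); lia.
rewrite lE in Z3 *.
have -> : q.+1 * w - (q * w + t) = u by lia.
have -> : w - t = u by lia.
rewrite !mulnDr => H1 H2; subst w; nia.
Qed.

(** Exchange: [S] minus the prefix and the prefix minus [S] have equal size, and the maximum [c] of
    [f] on the former is at most every value on the latter. *)
Lemma sum_set_le_prefix (n : nat) (f : 'I_n -> nat) (S : {set 'I_n}) :
    (forall i j : 'I_n, i <= j -> f j <= f i) ->
  \sum_(i in S) f i <= \sum_(i < n | i < #|S|) f i.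
Proof.
move=> fmono; set k := #|S|; pose P := [set i : 'I_n | i < k].
have kn : k <= n by rewrite /k (leq_trans (max_card _)) // card_ord.
have cardP : #|P| = k.
  rewrite -sum1_card (eq_bigl (fun i : 'I_n => i < k)); last by move=> i; rewrite inE.
  by rewrite (big_ord_narrow kn) sum1_card card_ord.
rewrite [leqRHS](eq_bigl (fun i => i \in P)); last by move=> i; rewrite inE.
rewrite (big_setID P) [leqRHS](big_setID S) /= setIC leq_add2l.
have cardD : #|S :\: P| = #|P :\: S|.
  by have := cardsID S P; rewrite setIC cardP -[k](cardsID P S) => /addnI ->.
pose c := \max_(j in S :\: P) f j.
apply: leq_trans (_ : #|S :\: P| * c <= _).
  by rewrite -sum_nat_const; apply: leq_sum => j jS; apply: leq_bigmax_cond.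
rewrite cardD -sum_nat_const; apply: leq_sum => i; rewrite !inE => /andP[_ ik].
apply/bigmax_leqP => j; rewrite !inE -leqNgt => /andP[kj _].
by apply: fmono; lia.
Qed.

(** * Clique factors *)

Lemma sum_ord_range (n lo hi : nat) :
  \sum_(i < n) (lo <= i < hi) = minn hi n - lo.
Proof.
elim: n => [|n IHn]; first by rewrite big_ord0; lia.
by rewrite big_ord_recr /= IHn; case: (leqP lo n); case: (ltnP n hi) => /=; lia.
Qed.

Lemma divn_eq_range (w x b : nat) : 0 < w -> (x %/ w == b) = (b * w <= x < b.+1 * w).
Proof. by move=> w_gt0; rewrite -leq_divRL // -ltn_divLR // ltnS eqn_leq andbC. Qed.

Lemma clique_factorE (h n : nat) (x y : 'I_n) : h.+1 %| n ->
  clique_factor h x y = (x != y) && (x %/ h.+1 == y %/ h.+1).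
Proof.
move=> wn; have blockE b (z : 'I_n) : (z \in block h n b) = (z %/ h.+1 == b).
  rewrite inE divn_eq_range //; apply/existsP/idP => [[t /eqP->]|/andP[bz zb]].
    by have := ltn_ord t; lia.
  have tP : z - b * h.+1 < h.+1 by lia.
  by exists (Ordinal tP) => /=; apply/eqP; lia.
rewrite /clique_factor; congr (_ && _); apply/existsP/eqP => [[b]|xy].
  by rewrite !blockE => /andP[/eqP-> /eqP->].
have bP : x %/ h.+1 < n %/ h.+1 by rewrite ltn_divLR // divnK.
by exists (Ordinal bP); rewrite !blockE /= -xy eqxx.
Qed.

Lemma degreeE (T : finType) (e : rel T) x : degree e x = \sum_y e x y.
Proof.
rewrite /degree -sum1dep_card big_mkcond; apply: eq_bigr => y _.
by case: (e x y).
Qed.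

Lemma even_sum_degree (T : finType) (e : rel T) :
  simple_graph e -> ~~ odd (\sum_x degree e x).
Proof.
move=> [esym eirr]; have -> : \sum_x degree e x = #|[set a | e a.1 a.2]|.
  rewrite -sum_rowsum; apply: eq_bigr => x _; rewrite degreeE.
  by apply: eq_bigr => y _; rewrite inE.
apply: even_symmetric_arcs => a; rewrite !inE /=; first by rewrite esym.
by apply: contraTneq => ->; rewrite eirr.
Qed.

(** The part of the block of [x] from index [k] on, less [x] itself. *)
Lemma sum_clique_factor_from (h n k : nat) (x : 'I_n) : h.+1 %| n -> k <= x ->
  \sum_(y < n | k <= y) clique_factor h x y
    = (x %/ h.+1).+1 * h.+1 - maxn k (x %/ h.+1 * h.+1) - 1.
Proof.
move=> wn kx; set b := x %/ h.+1.
have bx : b * h.+1 <= x < b.+1 * h.+1 by rewrite -divn_eq_range.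
have bn : b.+1 * h.+1 <= n by rewrite -leq_divRL // ltn_divLR // divnK.
have E : \sum_(y < n) (maxn k (b * h.+1) <= y < b.+1 * h.+1)
    = 1 + \sum_(y < n | k <= y) clique_factor h x y.
  rewrite [in RHS]big_mkcond (bigD1 x) //= [in RHS](bigD1 x) //= addnA.
  congr (_ + _).
    rewrite kx clique_factorE // eqxx geq_max kx /=.
    by move: bx => ->.
  apply: eq_bigr => y yx; rewrite clique_factorE // eq_sym yx -/b /= eq_sym.
  by rewrite divn_eq_range // geq_max -andbA; case: (k <= y).
by move: E; rewrite sum_ord_range (minn_idPl bn); lia.
Qed.

(** * Necessity of the inequalities, and their form as cut conditions for prefixes *)

Section DegreeBounds.

Variables (h n : nat) (d : 'I_n -> nat).
Hypothesis d_ge_h : forall i : 'I_n, h <= d i.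

Lemma realizable_bound (e : rel 'I_n) (k : nat) :
    h.+1 %| n -> simple_graph e -> (forall x, degree e x = d x) ->
    subrel (@clique_factor h n) e -> 1 <= k <= n ->
  \sum_(i < n | i < k) d i <= k * (k - 1)
    + \sum_(i < n | k <= i < k + 1 + h - k %% h.+1) minn (d i - h + k %% h.+1) k
    + \sum_(i < n | k + 1 + h - k %% h.+1 <= i) minn (d i - h) k.
Proof.
move=> wn [esym eirr] ed He /andP[k_gt0 kn]; set s := k %% h.+1.
have card_prefix : \sum_(i < n) (i < k) = k.
  by have := sum_ord_range n 0 k; rewrite (minn_idPl kn) subn0.
pose N (x : 'I_n) := \sum_(i < n | i < k) e x i.
have Nk x : N x <= k.
  rewrite /N -[leqRHS]card_prefix big_mkcond /=; apply: leq_sum => i _.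
  by case: ltnP => // _; case: (e x i).
have sw : s < h.+1 by rewrite ltn_mod.
have kE : k = k %/ h.+1 * h.+1 + s by rewrite -divn_eq.
(* The block cut by the prefix has [s] vertices inside it and ends at index [k + 1 + h - s]; a later
   vertex in it keeps only [h - s] block-mates outside the prefix. *)
have Nd (x : 'I_n) : k <= x -> N x + (if x < k + 1 + h - s then h - s else h) <= d x.
  move=> kx; rewrite -ed degreeE (bigID (fun y : 'I_n => y < k)) /= leq_add2l.
  rewrite [leqRHS](eq_bigl (fun y : 'I_n => k <= y)); last by move=> y; rewrite -leqNgt.
  apply: leq_trans (_ : \sum_(y < n | k <= y) clique_factor h x y <= _); last first.
    by apply: leq_sum => y _; case xy: (clique_factor h x y); rewrite // (He _ _ xy).
  rewrite sum_clique_factor_from //.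
  have bx : x %/ h.+1 * h.+1 <= x < (x %/ h.+1).+1 * h.+1 by rewrite -divn_eq_range.
  have qb : k %/ h.+1 <= x %/ h.+1 by apply: leq_div2r.
  move: bx qb kE kx sw; move: (x %/ h.+1) (k %/ h.+1) => b q;
    move: s (x : nat) => r j; clear.
  move=> bx; rewrite leq_eqVlt => /predU1P[-> kE kx sw|qb kE kx sw].
    by case: (ltnP j (k + 1 + h - r)) => jk; move: bx; rewrite mulSn; lia.
  have qbw : q.+1 * h.+1 <= b * h.+1 by rewrite leq_mul2r qb orbT.
  by rewrite ltnNge (_ : k + 1 + h - r <= j) /=; lia.
have -> : \sum_(i < n | i < k) d i = \sum_(i < n | i < k) N i + \sum_(i < n | k <= i) N i.
  transitivity (\sum_(i < n | i < k) (N i + \sum_(j < n | k <= j) e i j)).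
    apply: eq_bigr => i ik; rewrite -ed degreeE (bigID (fun y : 'I_n => y < k)) /=.
    by congr (_ + _); apply: eq_bigl => j; rewrite -leqNgt.
  rewrite big_split /=; congr (_ + _); rewrite exchange_big /=.
  by apply: eq_bigr => j _; apply: eq_bigr => i _; rewrite esym.
rewrite -addnA; apply: leq_add.
  apply: leq_trans (_ : \sum_(i < n | i < k) (k - 1) <= _); last first.
    rewrite -[X in X * _]card_prefix big_distrl [leqLHS]big_mkcond /=.
    by apply: leq_sum => i _; case: ltnP; rewrite ?mul1n.
  apply: leq_sum => i ik; suff : N i < k by lia.
  rewrite -[leqRHS]card_prefix /N [in ltnLHS]big_mkcond /=.
  rewrite (bigD1 i) //= [leqRHS](bigD1 i) //= ik eirr add0n ltnS.
  by apply: leq_sum => j _; case: ltnP => // _; case: (e i j).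
rewrite [leqLHS]big_mkcond [X in _ <= X + _]big_mkcond [X in _ <= _ + X]big_mkcond.
rewrite -big_split /=; apply: leq_sum => i _.
have := Nk i; have := Nd i; have := d_ge_h i.
move: (N i) (d i) sw => Ni di; clear; case: (leqP k i) => [ki sw hd /(_ isT)|ik sw _ _ _].
  by case: ltnP => /= iE Nd_i Nk_i; rewrite ?addn0 leq_min Nk_i andbT; lia.
by [].
Qed.

(** This is the cut condition for the prefixes of lengths [k] and [l]: [k * h.+1] minus the product
    with [k %% h.+1] counts their pairs within a common block. The truncated difference vanishes
    once [l] passes the end of the block cut at [k]. *)
Lemma excess_prefix_bound (k l : nat) : 1 <= k <= n -> k <= l ->
  \sum_(i < n | i < k) d i <= k * (k - 1)
    + \sum_(i < n | k <= i < k + 1 + h - k %% h.+1) minn (d i - h + k %% h.+1) k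
    + \sum_(i < n | k + 1 + h - k %% h.+1 <= i) minn (d i - h) k ->
  \sum_(i < n | i < k) (d i - h) + \sum_(i < n | i < l) (d i - h)
     + k * h.+1 <=
  k * l + \sum_(i < n) (d i - h) + k %% h.+1 * ((k %/ h.+1).+1 * h.+1 - l).
Proof.
move=> /andP[k_gt0 kn] kl; set s := k %% h.+1 => cond.
have kE : k = k %/ h.+1 * h.+1 + s by rewrite -divn_eq.
have -> : (k %/ h.+1).+1 * h.+1 = k + 1 + h - s by move: kE; clear; lia.
have sw : s < h.+1 by rewrite ltn_mod.
have card_prefix : \sum_(i < n) (i < k) = k.
  by have := sum_ord_range n 0 k; rewrite (minn_idPl kn) subn0.
have dE : \sum_(i < n | i < k) d i = \sum_(i < n | i < k) (d i - h) + k * h.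
  rewrite -[X in X * h]card_prefix big_distrl [X in _ + X](bigID (fun i : 'I_n => i < k)) /=.
  rewrite [X in _ + (_ + X)]big1 ?addn0 => [|i /negbTE-> //].
  by rewrite -big_split /=; apply: eq_bigr => i ->; rewrite mul1n subnK.
rewrite [X in _ <= _ + X + _](bigID (fun i : 'I_n => i < l)) /=.
(* Each minimum is bounded by [k] at indices below [l] and by its other argument from [l] on. *)
have tail : \sum_(i < n | k <= i < k + 1 + h - s) minn (d i - h + s) k
    + \sum_(i < n | k + 1 + h - s <= i) minn (d i - h) k
  <= k * (l - k) + \sum_(i < n | ~~ (i < l)) (d i - h) + s * (k + 1 + h - s - l).
  apply: leq_trans (_ : \sum_(i < n) (k * (k <= i < l) + (if ~~ (i < l) then d i - h else 0)
      + s * (l <= i < k + 1 + h - s)) <= _); last first.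
    rewrite !big_split /= -!big_distrr /= !sum_ord_range -big_mkcond /=.
    by rewrite !leq_add ?leq_mul ?leq_sub ?geq_minl.
  rewrite [X in X + _]big_mkcond [X in _ + X]big_mkcond -big_split /=.
  apply: leq_sum => i _; move: (d i) sw kl => di; clear => sw kl.
  case: (leqP k i) => [ki|ik] /=; last by rewrite (_ : (k + 1 + h - s <= i) = false) //; lia.
  rewrite !(leqNgt _ i); case: (ltnP i l) => il /=.
    by case: ltnP => iE /=; rewrite muln0 muln1 !addn0 ?add0n geq_minr.
  by case: ltnP => iE /=; rewrite !muln0 ?muln1 ?addn0 !add0n ?addn0 geq_minl.
move: cond tail; rewrite dE -addnA; move: (\sum_(i < n | ~~ _) _) => F0.
move: (\sum_(i < n | i < k) _) (\sum_(i < n | i < l) _) => F1 F2.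
move: (\sum_(i < n | _) _ + _) => G cond tail.
have := leq_trans cond (leq_add (leqnn _) tail).
have klE : k * (k - 1) + k * (l - k) + k = k * l.
  rewrite -mulnDr addnC -mulnS; congr (_ * _); lia.
by rewrite mulnS; move: klE; clear; lia.
Qed.

End DegreeBounds.

(** * Counting multipartite edges between two vertex sets *)

Definition multipartite (w n : nat) : rel 'I_n := fun x y => x %/ w != y %/ w.

(** Indexing blocks by ['I_n] avoids a type for the number of blocks; surplus indices count zero. *)
Definition block_size (w n : nat) (S : {set 'I_n}) (b : 'I_n) : nat :=
  \sum_(x in S) (x %/ w == b).

Lemma sum_block_index (w n : nat) (x : 'I_n) (F : nat -> nat) :
  \sum_(b < n) (x %/ w == b) * F b = F (x %/ w).
Proof.
have bP : x %/ w < n by apply: leq_ltn_trans (leq_div _ _) _.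
rewrite (bigD1 (Ordinal bP)) //= eqxx mul1n big1 ?addn0 // => b.
by rewrite -val_eqE /= eq_sym => /negbTE->.
Qed.

Lemma sum_block_size (w n : nat) (S : {set 'I_n}) :
  \sum_b block_size w S b = #|S|.
Proof.
rewrite exchange_big -sum1_card; apply: eq_bigr => x _ /=.
by rewrite -[RHS](sum_block_index w x (fun=> 1)); apply: eq_bigr => b _; rewrite muln1.
Qed.

Lemma block_size_le (w n : nat) (S : {set 'I_n}) b : 0 < w -> block_size w S b <= w.
Proof.
move=> w_gt0; apply: leq_trans (_ : \sum_(x < n) (x %/ w == b) <= _).
  by rewrite /block_size big_mkcond; apply: leq_sum => x _; case: (x \in S).
rewrite (eq_bigr (fun x : 'I_n => nat_of_bool (b * w <= x < b.+1 * w))).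
  by rewrite sum_ord_range mulSn leq_subLR addnC geq_minl.
by move=> x _; rewrite divn_eq_range.
Qed.

Lemma sum_multipartite (w n : nat) (S T : {set 'I_n}) :
  \sum_(x in S) \sum_(y in T) multipartite w x y
    + \sum_b block_size w S b * block_size w T b = #|S| * #|T|.
Proof.
have -> : \sum_b block_size w S b * block_size w T b
    = \sum_(x in S) \sum_(y in T) (x %/ w == y %/ w).
  under eq_bigr do rewrite big_distrl /=.
  rewrite exchange_big; apply: eq_bigr => x _ /=.
  rewrite (sum_block_index w x (fun b => \sum_(y in T) (y %/ w == b))).
  by apply: eq_bigr => y _; rewrite eq_sym.
rewrite -big_split /= -sum_nat_const; apply: eq_bigr => x _.
rewrite -big_split /= -sum1_card; apply: eq_bigr => y _.
by rewrite /multipartite; case: eqP.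
Qed.

(** * Sufficiency of the inequalities *)

Section Sufficiency.

Variables (h n : nat) (d : 'I_n -> nat).
Hypotheses (d_noninc : forall i j : 'I_n, i <= j -> d j <= d i)
  (d_ge_h : forall i : 'I_n, h <= d i).
Hypothesis bound : forall k, 1 <= k <= n ->
  \sum_(i < n | i < k) d i <= k * (k - 1)
    + \sum_(i < n | k <= i < k + 1 + h - k %% h.+1) minn (d i - h + k %% h.+1) k
    + \sum_(i < n | k + 1 + h - k %% h.+1 <= i) minn (d i - h) k.

(** Pass to prefixes for the degree sums, and bound the pairs within blocks by [sum_mul_truncated];
    the truncated term there is the one of [excess_prefix_bound]. The empty [S] is treated apart
    since [bound] starts at [k = 1]. *)
Lemma cut_bound_le (S T : {set 'I_n}) : #|S| <= #|T| ->
  \sum_(x in S) (d x - h) + \sum_(y in T) (d y - h) <=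
    \sum_(x in S) \sum_(y in T) multipartite h.+1 x y + \sum_x (d x - h).
Proof.
move=> leST; have := sum_multipartite h.+1 S T.
have f_noninc (i j : 'I_n) : i <= j -> d j - h <= d i - h.
  by move=> /d_noninc; apply: leq_sub2r.
have := sum_set_le_prefix S f_noninc; have := sum_set_le_prefix T f_noninc.
have [/cards0_eq->|S_gt0] := posnP #|S|.
  rewrite !big_set0 !add0n => _ _ _; rewrite big_mkcond; apply: leq_sum => x _.
  by case: (x \in T).
have kn : 1 <= #|S| <= n by rewrite S_gt0 -[leqRHS](card_ord n) max_card.
have := excess_prefix_bound d_ge_h kn leST (bound kn).
have := @sum_mul_truncated _ h.+1 (#|S| %/ h.+1) (#|S| %% h.+1)
  (block_size h.+1 S) (block_size h.+1 T) (fun b => block_size_le S b (ltn0Sn h))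
  (fun b => block_size_le T b (ltn0Sn h)) (ltn_pmod _ (ltn0Sn h)).
rewrite !sum_block_size -divn_eq => /(_ erefl leST).
rewrite [h.+1 * _]mulnC.
move: (_ %% _ * _) (\sum_b _) (\sum_(x in S) \sum_(y in T) _) => X1 X2 X3.
move: (\sum_(i in S) _) (\sum_(i in T) _) (#|S| * #|T|) (#|S| * h.+1).
move: (\sum_(i < n | i < #|S|) _) (\sum_(i < n | i < #|T|) _) (\sum_(i < n) _).
by clear; lia.
Qed.

Lemma cut_bound (S T : {set 'I_n}) :
  \sum_(x in S) (d x - h) + \sum_(y in T) (d y - h) <=
    \sum_(x in S) \sum_(y in T) multipartite h.+1 x y + \sum_x (d x - h).
Proof.
have [|/ltnW leTS] := leqP #|S| #|T|; first exact: cut_bound_le.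
rewrite addnC exchange_big; apply: leq_trans (cut_bound_le leTS) _.
rewrite leq_add2r; apply: leq_sum => y _; apply: leq_sum => x _.
by rewrite /multipartite eq_sym.
Qed.

Lemma bound_realizable : ~~ odd (\sum_i d i) -> h.+1 %| n -> Hrealizable h d.
Proof.
move=> evd wn; set K := multipartite h.+1.
have [A [AK rA cA]] : exists A : {set 'I_n * 'I_n},
    [/\ forall x y, (x, y) \in A -> K n x y, forall x, rowsum A x = d x - h
      & forall y, colsum A y = d y - h].
  apply: transportation => // S T; have := cut_bound S T.
  rewrite [X in _ <= _ + X -> _](bigID (mem T)) /= [X in X <= _ -> _]addnC.
  by rewrite [X in _ <= X -> _]addnCA leq_add2l.
have dE : \sum_i d i = \sum_i (d i - h) + n * h.
  rewrite -[X in X * h]card_ord -sum_nat_const -big_split /=.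
  by apply: eq_bigr => i _; rewrite subnK.
have evf : ~~ odd (\sum_i (d i - h)).
  (* [n * h] is a multiple of [h * h.+1], so subtracting [h] everywhere preserves parity. *)
  have evnh : odd (n * h) = false.
    by case/dvdnP: wn => q ->; rewrite !oddM /= -andbA andNb andbF.
  by move: evd; rewrite dE oddD evnh addbF.
have Ksym : symmetric (K n) by move=> x y; rewrite /K /multipartite eq_sym.
have Kirr : irreflexive (K n) by move=> x; rewrite /K /multipartite eqxx.
have Kmul (x y z : 'I_n) : K n x y -> K n z x || K n z y.
  rewrite -negb_and; apply: contraNN => /andP[/eqP<- /eqP<-] //.
have [B [BK Bsym rB]] := symmetrization Ksym Kirr Kmul evf
  (fun a => match a with (x, y) => @AK x y end) rA cA.
have BC x y : (x, y) \in B -> clique_factor h x y = false.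
  by move=> /BK; rewrite clique_factorE // /K /multipartite => /negbTE /= ->; rewrite andbF.
split=> //; exists (fun x y => clique_factor h x y || ((x, y) \in B)); split.
- split=> [x y|x]; last first.
    rewrite clique_factorE // eqxx /=; apply/negP => /BK; by rewrite Kirr.
  rewrite !clique_factorE // eq_sym [y %/ _ == _]eq_sym; congr (_ || _).
  by apply/idP/idP => /Bsym.
- move=> x; rewrite degreeE.
  rewrite (eq_bigr (fun y => clique_factor h x y + ((x, y) \in B))); last first.
    by move=> y _; have := @BC x y; case: (_ \in B) => [->|_] //; rewrite orbF addn0.
  rewrite big_split /= [X in _ + X]rB.
  have := sum_clique_factor_from wn (leq0n x); rewrite max0n mulSn addnK subn1 /=.
  by move=> ->; rewrite subnKC.
- by move=> x y /= ->.
Qed.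

End Sufficiency.

(* The index i : 'I_n stands for i + 1 in 1-based numbering; all sums range
   over indices of the sequence only, so for k = n both right-hand sums are 0. *)
Theorem theorem2p1 (h n : nat) (d : 'I_n -> nat)
  (n_ge1 : 1 <= n)
  (d_noninc : forall i j : 'I_n, i <= j -> d j <= d i)
  (d_ge_h : forall i : 'I_n, h <= d i)
  (d_pos : forall i : 'I_n, 0 < d i) :
  Hrealizable h d <->
  [/\ ~~ odd (\sum_(i < n) d i),
      h.+1 %| n
    & forall k : nat, 1 <= k <= n ->
        let s := k %% h.+1 in
        \sum_(i < n | i < k) d i <=
          k * (k - 1)
          + \sum_(i < n | k <= i < k + 1 + h - s) minn (d i - h + s) k
          + \sum_(i < n | k + 1 + h - s <= i) minn (d i - h) k].
Proof.
split=> [[wn [e [simple_e ed He]]]|[evd wn bound]]; last exact: bound_realizable.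
split=> //; first by rewrite -(eq_bigr _ (fun x _ => ed x)); apply: even_sum_degree.
by move=> k kn; apply: (realizable_bound d_ge_h wn simple_e ed He kn).
Qed.
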